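(* Let $u:A\rightarrow B$ be a ring morphism. The following are equivalent: (i) $u$ is a strong PSI-morphism. (ii) The base-changed morphism $u\otimes_A C:C\rightarrow C \otimes_A B$ is a strong PSI-morphism for each ring morphism $v:A\rightarrow C$. (iii) The base-changed morphism $u\otimes_A C:C\rightarrow B \otimes_A C$ is a PSI-morphism for each ring morphism $A\rightarrow C$. (iv) The polynomial morphism $u\otimes_A A[X]:A[X]\rightarrow B[X]$ (with $X$ an indeterminate) is a PSI-morphism.
   Context: All rings are commutative and unitary, and ring morphisms are unitary. For a ring morphism $u:A\to B$, a proper ideal $I$ of $B$ is called $A$-prime if $u(a)b\in I$ with $a\in A$ and $b\in B$ implies that $u(a)\in I$ or $b\in I$. The morphism $u$ is a PSI-morphism if every $A$-prime ideal of $B$ is a prime ideal of $B$. For $P\in\mathrm{Spec}(A)$, $k_A(P)=A_P/PA_P$ denotes the residue field of $A$ at $P$. The morphism $u$ is a strong PSI-morphism if for every $P\in\mathrm{Spec}(A)$ with $k_A(P)\otimes_A B\neq 0$, the canonical map $k_A(P)\to k_A(P)\otimes_A B$ is an isomorphism. *)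

(* Defs.v *)
(* Rings are [comPzRingType]s, so that the zero ring is allowed: a base change
   [C -> C (x)_A B] may well have zero target.  For that reason the quotients,
   fractions and polynomials of MathComp, which require nonzero rings (or
   integral domains), cannot be used, and their versions for arbitrary
   commutative rings are set up here. *)
From HB Require Import structures.
From mathcomp Require Import all_boot ssralg generic_quotient ring.
From mathcomp Require Import boolp classical_sets.

Set Implicit Arguments.
Unset Strict Implicit.
Unset Printing Implicit Defensive.

Import GRing.Theory.
Local Open Scope ring_scope.
Local Open Scope quotient_scope.
Local Open Scope classical_set_scope.
Local Obligation Tactic := idtac.

Definition is_ideal (R : comPzRingType) (I : set R) : Prop :=
  [/\ I 0, forall x y, I x -> I y -> I (x + y) & forall a x, I x -> I (a * x)].

Definition is_proper_ideal (R : comPzRingType) (I : set R) : Prop :=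
  is_ideal I /\ I <> [set: R].

Definition is_prime_ideal (R : comPzRingType) (I : set R) : Prop :=
  is_proper_ideal I /\ forall a b, I (a * b) -> I a \/ I b.

Record spectrum (R : comPzRingType) := Spectrum {
  spectrum_set :> set R;
  spectrumP : is_prime_ideal spectrum_set
}.

Definition ideal_span (R : comPzRingType) (S : set R) : set R :=
  [set x | forall I : set R, is_ideal I -> S `<=` I -> I x].

Lemma ideal_span_ideal (R : comPzRingType) (S : set R) :
  is_ideal (ideal_span S).
Proof.
split=> [I [I0 _ _] _ //|x y xS yS I iI SI|a x xS I iI SI];
  have [_ ID IM] := iI.
- by apply: ID; [apply: xS|apply: yS].
- by apply: IM; apply: xS.
Qed.

(* A commutative ring presented by a type of representatives together with an
   equivalence relation for which the ring laws hold. *)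
Record ring_setoid := RingSetoid {
  rs_sort :> choiceType;
  rs_eq : rs_sort -> rs_sort -> Prop;
  rs_zero : rs_sort;
  rs_one : rs_sort;
  rs_opp : rs_sort -> rs_sort;
  rs_add : rs_sort -> rs_sort -> rs_sort;
  rs_mul : rs_sort -> rs_sort -> rs_sort;
  rs_refl : forall x, rs_eq x x;
  rs_sym : forall x y, rs_eq x y -> rs_eq y x;
  rs_trans : forall y x z, rs_eq x y -> rs_eq y z -> rs_eq x z;
  rs_oppP : forall x x', rs_eq x x' -> rs_eq (rs_opp x) (rs_opp x');
  rs_addP : forall x x' y, rs_eq x x' -> rs_eq (rs_add x y) (rs_add x' y);
  rs_mulP : forall x x' y, rs_eq x x' -> rs_eq (rs_mul x y) (rs_mul x' y);
  rs_addA : forall x y z,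
    rs_eq (rs_add x (rs_add y z)) (rs_add (rs_add x y) z);
  rs_addC : forall x y, rs_eq (rs_add x y) (rs_add y x);
  rs_add0 : forall x, rs_eq (rs_add rs_zero x) x;
  rs_addN : forall x, rs_eq (rs_add (rs_opp x) x) rs_zero;
  rs_mulA : forall x y z,
    rs_eq (rs_mul x (rs_mul y z)) (rs_mul (rs_mul x y) z);
  rs_mulC : forall x y, rs_eq (rs_mul x y) (rs_mul y x);
  rs_mul1 : forall x, rs_eq (rs_mul rs_one x) x;
  rs_mulD : forall x y z,
    rs_eq (rs_mul (rs_add x y) z) (rs_add (rs_mul x z) (rs_mul y z))
}.

Section RingSetoidQuotient.
Variable S : ring_setoid.

Definition rs_rel : rel S := fun x y => `[< rs_eq x y >].

Lemma rs_rel_equiv : equiv_class_of rs_rel.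
Proof.
split=> [x|x y|y x z].
- by apply/asboolP; exact: rs_refl.
- by apply/asboolP/asboolP; exact: rs_sym.
- by move=> /asboolP xy /asboolP yz; apply/asboolP; exact: rs_trans xy yz.
Qed.

Canonical rs_rel_equiv_rel := EquivRelPack rs_rel_equiv.
Canonical rs_rel_encModRel := defaultEncModRel rs_rel.

Definition rs_quot := {eq_quot rs_rel}.
HB.instance Definition _ : EqQuotient S rs_rel rs_quot :=
  EqQuotient.on rs_quot.
HB.instance Definition _ := Choice.on rs_quot.

Definition rs_class (x : S) : rs_quot := \pi_rs_quot x.

Lemma rs_classP x y : rs_class x = rs_class y <-> rs_eq x y.
Proof.
split=> [/eqP|xy]; first by rewrite /rs_class piE => /asboolP.
by apply/eqP; rewrite /rs_class piE; apply/asboolP.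
Qed.

Lemma rs_repr x : rs_eq (repr (rs_class x)) x.
Proof. by apply/rs_classP; rewrite /rs_class reprK. Qed.

Lemma rs_quotP (Q : rs_quot -> Prop) : (forall x, Q (rs_class x)) -> forall q, Q q.
Proof. by move=> HQ q; rewrite -[q]reprK; apply: HQ. Qed.

Definition rs_quot_zero := rs_class (@rs_zero S).
Definition rs_quot_one := rs_class (@rs_one S).
Definition rs_quot_opp (p : rs_quot) := rs_class (rs_opp (repr p)).
Definition rs_quot_add (p q : rs_quot) := rs_class (rs_add (repr p) (repr q)).
Definition rs_quot_mul (p q : rs_quot) := rs_class (rs_mul (repr p) (repr q)).

Fact rs_quot_oppE x : rs_quot_opp (rs_class x) = rs_class (rs_opp x).
Proof. exact/rs_classP/rs_oppP/rs_repr. Qed.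

Fact rs_quot_addE x y : rs_quot_add (rs_class x) (rs_class y) = rs_class (rs_add x y).
Proof.
apply/rs_classP; apply: rs_trans (rs_addP _ (rs_repr x)) _.
apply: rs_trans (rs_addC _ _) _; apply: rs_trans (rs_addP _ (rs_repr y)) _.
exact: rs_addC.
Qed.

Fact rs_quot_mulE x y : rs_quot_mul (rs_class x) (rs_class y) = rs_class (rs_mul x y).
Proof.
apply/rs_classP; apply: rs_trans (rs_mulP _ (rs_repr x)) _.
apply: rs_trans (rs_mulC _ _) _; apply: rs_trans (rs_mulP _ (rs_repr y)) _.
exact: rs_mulC.
Qed.

Fact rs_quot_addA : associative rs_quot_add.
Proof.
do 3![elim/rs_quotP=> ?]; rewrite !rs_quot_addE; exact/rs_classP/rs_addA.
Qed.
Fact rs_quot_addC : commutative rs_quot_add.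
Proof. do 2![elim/rs_quotP=> ?]; rewrite !rs_quot_addE; exact/rs_classP/rs_addC. Qed.
Fact rs_quot_add0 : left_id rs_quot_zero rs_quot_add.
Proof. by elim/rs_quotP=> ?; rewrite rs_quot_addE; exact/rs_classP/rs_add0. Qed.
Fact rs_quot_addN : left_inverse rs_quot_zero rs_quot_opp rs_quot_add.
Proof. by elim/rs_quotP=> ?; rewrite rs_quot_oppE rs_quot_addE; exact/rs_classP/rs_addN. Qed.
Fact rs_quot_mulA : associative rs_quot_mul.
Proof.
do 3![elim/rs_quotP=> ?]; rewrite !rs_quot_mulE; exact/rs_classP/rs_mulA.
Qed.
Fact rs_quot_mulC : commutative rs_quot_mul.
Proof. do 2![elim/rs_quotP=> ?]; rewrite !rs_quot_mulE; exact/rs_classP/rs_mulC. Qed.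
Fact rs_quot_mul1 : left_id rs_quot_one rs_quot_mul.
Proof. by elim/rs_quotP=> ?; rewrite rs_quot_mulE; exact/rs_classP/rs_mul1. Qed.
Fact rs_quot_mulD : left_distributive rs_quot_mul rs_quot_add.
Proof.
do 3![elim/rs_quotP=> ?]; rewrite rs_quot_addE !rs_quot_mulE rs_quot_addE; exact/rs_classP/rs_mulD.
Qed.

HB.instance Definition _ := GRing.isZmodule.Build rs_quot rs_quot_addA rs_quot_addC rs_quot_add0 rs_quot_addN.
HB.instance Definition _ :=
  GRing.Zmodule_isComPzRing.Build rs_quot rs_quot_mulA rs_quot_mulC rs_quot_mul1 rs_quot_mulD.

Lemma rs_class0 : rs_class (@rs_zero S) = 0. Proof. by []. Qed.
Lemma rs_class1 : rs_class (@rs_one S) = 1. Proof. by []. Qed.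
Lemma rs_classN x : rs_class (rs_opp x) = - rs_class x.
Proof. by rewrite -rs_quot_oppE. Qed.
Lemma rs_classD x y : rs_class (rs_add x y) = rs_class x + rs_class y.
Proof. by rewrite -rs_quot_addE. Qed.
Lemma rs_classM x y : rs_class (rs_mul x y) = rs_class x * rs_class y.
Proof. by rewrite -rs_quot_mulE. Qed.

End RingSetoidQuotient.

Section QuotientRing.
Variables (R : comPzRingType) (I : set R) (iI : is_ideal I).

Definition ideal_eq (x y : R) : Prop := I (x - y).
Fact is_ideal0 : I 0. Proof. by case: iI. Qed.
Fact is_idealD x y : I x -> I y -> I (x + y). Proof. by case: iI => _ + _; apply. Qed.
Fact is_idealM a x : I x -> I (a * x). Proof. by case: iI => _ _; apply. Qed.
Fact is_idealN x : I x -> I (- x). Proof. by rewrite -mulN1r; exact: is_idealM. Qed.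
Fact ideal_eqE x y : x = y -> ideal_eq x y.
Proof. by move->; rewrite /ideal_eq subrr; exact: is_ideal0. Qed.

Program Definition quotient_setoid : ring_setoid :=
  @RingSetoid R ideal_eq 0 1 -%R +%R *%R _ _ _ _ _ _ _ _ _ _ _ _ _ _.
Next Obligation. by move=> x; exact: ideal_eqE. Qed.
Next Obligation. by move=> x y /is_idealN; rewrite opprB. Qed.
Next Obligation. by move=> y x z xy yz; have := is_idealD xy yz; rewrite addrA subrK. Qed.
Next Obligation. by move=> x y /is_idealN; rewrite opprD. Qed.
Next Obligation. by move=> x x' y; rewrite /ideal_eq opprD addrACA subrr addr0. Qed.
Next Obligation. by move=> x x' y /(is_idealM y); rewrite /ideal_eq -mulrBl mulrC. Qed.
Next Obligation. by move=> *; apply: ideal_eqE; rewrite addrA. Qed.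
Next Obligation. by move=> *; apply: ideal_eqE; rewrite addrC. Qed.
Next Obligation. by move=> *; apply: ideal_eqE; rewrite add0r. Qed.
Next Obligation. by move=> *; apply: ideal_eqE; rewrite addNr. Qed.
Next Obligation. by move=> *; apply: ideal_eqE; rewrite mulrA. Qed.
Next Obligation. by move=> *; apply: ideal_eqE; rewrite mulrC. Qed.
Next Obligation. by move=> *; apply: ideal_eqE; rewrite mul1r. Qed.
Next Obligation. by move=> *; apply: ideal_eqE; rewrite mulrDl. Qed.

Definition quotient_ring : comPzRingType := rs_quot quotient_setoid.

Definition quotient_proj (x : R) : quotient_ring := @rs_class quotient_setoid x.

Lemma quotient_proj_is_zmod : zmod_morphism quotient_proj.
Proof.
move=> x y; rewrite [LHS](@rs_classD quotient_setoid).
by congr (_ + _); exact: (@rs_classN quotient_setoid).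
Qed.
Lemma quotient_proj_is_monoid : monoid_morphism quotient_proj.
Proof. by split=> // x y; exact: (@rs_classM quotient_setoid). Qed.

HB.instance Definition _ :=
  GRing.isZmodMorphism.Build R quotient_ring quotient_proj quotient_proj_is_zmod.
HB.instance Definition _ :=
  GRing.isMonoidMorphism.Build R quotient_ring quotient_proj
    quotient_proj_is_monoid.

End QuotientRing.

Section Localization.
Variables (R : comPzRingType) (P : spectrum R).

Lemma spectrum1 : ~ spectrum_set P 1.
Proof.
case: (spectrumP P) => -[[_ _ PM] PT] _ P1; apply: PT.
by apply/seteqP; split=> // x _; rewrite -[x]mulr1; exact: PM.
Qed.

Lemma spectrumM a b : ~ spectrum_set P a -> ~ spectrum_set P b -> ~ spectrum_set P (a * b).
Proof. by move=> nPa nPb; case: (spectrumP P) => _ PP /PP[]. Qed.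

Definition fraction := {x : R * R | x.2 \notin (P : set R)}.

Definition num (x : fraction) : R := (val x).1.
Definition den (x : fraction) : R := (val x).2.

Definition frac (a s : R) (sP : ~ spectrum_set P s) : fraction :=
  @exist (R * R)%type (fun x => x.2 \notin (P : set R)) (a, s)
    (negbT (memNset sP)).

Lemma num_frac a s (sP : ~ spectrum_set P s) : num (frac a sP) = a.
Proof. by []. Qed.
Lemma den_frac a s (sP : ~ spectrum_set P s) : den (frac a sP) = s.
Proof. by []. Qed.

Lemma denP (x : fraction) : ~ spectrum_set P (den x).
Proof. by move=> /mem_set xP; have /negP := valP x; apply. Qed.

Definition frac_eq (x y : fraction) : Prop :=
  exists2 t, ~ spectrum_set P t & t * (num x * den y) = t * (num y * den x).

Fact frac_eqE x y : num x * den y = num y * den x -> frac_eq x y.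
Proof. by move=> xy; exists 1; [exact: spectrum1|rewrite xy]. Qed.

Definition frac_opp (x : fraction) := frac (- num x) (@denP x).
Definition frac_add (x y : fraction) :=
  frac (num x * den y + num y * den x) (spectrumM (@denP x) (@denP y)).
Definition frac_mul (x y : fraction) :=
  frac (num x * num y) (spectrumM (@denP x) (@denP y)).

Definition fracE := (num_frac, den_frac).

Program Definition localization_setoid : ring_setoid :=
  @RingSetoid fraction frac_eq (frac 0 spectrum1) (frac 1 spectrum1)
    frac_opp frac_add frac_mul _ _ _ _ _ _ _ _ _ _ _ _ _ _.
Next Obligation. by move=> x; exact: frac_eqE. Qed.
Next Obligation. by move=> x y [t tP e]; exists t. Qed.
Next Obligation.
move=> y x z [t tP e] [r rP f]; exists (t * r * den y).
  exact/spectrumM/denP/spectrumM.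
transitivity (r * den z * (t * (num x * den y))); first by ring.
transitivity (t * den x * (r * (num y * den z))); first by rewrite e; ring.
by rewrite f; ring.
Qed.
Next Obligation.
move=> x y [t tP e]; exists t => //; rewrite !fracE.
by rewrite !mulNr !mulrN e.
Qed.
Next Obligation.
move=> x x' y [t tP e]; exists t => //; rewrite !fracE.
transitivity (den y * den y * (t * (num x * den x')) +
  t * (num y * den y * den x * den x')); first by ring.
by rewrite e; ring.
Qed.
Next Obligation.
move=> x x' y [t tP e]; exists t => //; rewrite !fracE.
transitivity (num y * den y * (t * (num x * den x'))); first by ring.
by rewrite e; ring.
Qed.
Next Obligation. by move=> x y z; apply: frac_eqE; rewrite !fracE; ring. Qed.
Next Obligation. by move=> x y; apply: frac_eqE; rewrite !fracE; ring. Qed.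
Next Obligation. by move=> x; apply: frac_eqE; rewrite !fracE; ring. Qed.
Next Obligation. by move=> x; apply: frac_eqE; rewrite !fracE; ring. Qed.
Next Obligation. by move=> x y z; apply: frac_eqE; rewrite !fracE; ring. Qed.
Next Obligation. by move=> x y; apply: frac_eqE; rewrite !fracE; ring. Qed.
Next Obligation. by move=> x; apply: frac_eqE; rewrite !fracE; ring. Qed.
Next Obligation. by move=> x y z; apply: frac_eqE; rewrite !fracE; ring. Qed.

Definition localization : comPzRingType := rs_quot localization_setoid.

Definition loc_map (a : R) : localization :=
  @rs_class localization_setoid (frac a spectrum1).

Lemma loc_map_is_zmod : zmod_morphism loc_map.
Proof.
move=> x y; rewrite -[- loc_map y](@rs_classN localization_setoid).
rewrite -[RHS](@rs_classD localization_setoid).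
by apply/rs_classP/frac_eqE; rewrite !fracE; ring.
Qed.
Lemma loc_map_is_monoid : monoid_morphism loc_map.
Proof.
split=> // x y; rewrite -[RHS](@rs_classM localization_setoid).
by apply/rs_classP/frac_eqE; rewrite !fracE; ring.
Qed.
HB.instance Definition _ :=
  GRing.isZmodMorphism.Build R localization loc_map loc_map_is_zmod.
HB.instance Definition _ :=
  GRing.isMonoidMorphism.Build R localization loc_map loc_map_is_monoid.

Definition loc_ideal : set localization := ideal_span (loc_map @` P).

(* A_P / P A_P *)
Definition residue_field : comPzRingType :=
  @quotient_ring localization loc_ideal (ideal_span_ideal (loc_map @` P)).

Definition residue_map : {rmorphism R -> residue_field} :=
  @quotient_proj localization loc_ideal (ideal_span_ideal (loc_map @` P))
    \o loc_map.

End Localization.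

Section Tensor.
Variables (A B C : comPzRingType).
Variables (u : {rmorphism A -> B}) (v : {rmorphism A -> C}).

(* [s : seq (B * C)] stands for the formal sum of the b (x) c for (b, c) in s,
   and [tensor_eq] is the congruence defining B (x)_A C.  Negatives need not be
   adjoined formally, since (- b) (x) c is an opposite of b (x) c. *)
Inductive tensor_eq : seq (B * C) -> seq (B * C) -> Prop :=
| tensor_refl s : tensor_eq s s
| tensor_sym s t : tensor_eq s t -> tensor_eq t s
| tensor_trans t s r : tensor_eq s t -> tensor_eq t r -> tensor_eq s r
| tensor_cat s s' t t' :
    tensor_eq s s' -> tensor_eq t t' -> tensor_eq (s ++ t) (s' ++ t')
| tensor_catC s t : tensor_eq (s ++ t) (t ++ s)
| tensor_0 c : tensor_eq [:: (0, c)] [::]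
| tensor_Dl b b' c : tensor_eq [:: (b + b', c)] [:: (b, c); (b', c)]
| tensor_Dr b c c' : tensor_eq [:: (b, c + c')] [:: (b, c); (b, c')]
| tensor_balanced a b c : tensor_eq [:: (u a * b, c)] [:: (b, v a * c)].

Definition tensor_opp (s : seq (B * C)) := [seq (- x.1, x.2) | x <- s].
Definition tensor_mul (s t : seq (B * C)) :=
  [seq (x.1 * y.1, x.2 * y.2) | x <- s, y <- t].

Fact tensor_perm s t : perm_eq s t -> tensor_eq s t.
Proof.
move=> st; apply: (@catCA_perm_ind _ (tensor_eq s)) st (tensor_refl s).
move=> s1 s2 s3 /tensor_trans; apply.
by rewrite !catA; apply: tensor_cat; [exact: tensor_catC|exact: tensor_refl].
Qed.

Fact tensor_oppP s s' : tensor_eq s s' -> tensor_eq (tensor_opp s) (tensor_opp s').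
Proof.
elim=> {s s'} [s|s t _|t s r _ + _|s s' t t' _ + _|s t|c|b b' c|b c c'|a b c].
- exact: tensor_refl.
- exact: tensor_sym.
- exact: tensor_trans.
- rewrite /tensor_opp !map_cat; exact: tensor_cat.
- rewrite /tensor_opp !map_cat; exact: tensor_catC.
- rewrite /= oppr0; exact: tensor_0.
- rewrite /= opprD; exact: tensor_Dl.
- exact: tensor_Dr.
- rewrite /= -mulrN; exact: tensor_balanced.
Qed.

Fact tensor_mul1P s s' y :
  tensor_eq s s' -> tensor_eq (tensor_mul s [:: y]) (tensor_mul s' [:: y]).
Proof.
rewrite /tensor_mul !allpairs1r.
elim=> {s s'} [s|s t _|t s r _ + _|s s' t t' _ + _|s t|c|b b' c|b c c'|a b c].
- exact: tensor_refl.
- exact: tensor_sym.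
- exact: tensor_trans.
- rewrite !map_cat; exact: tensor_cat.
- rewrite !map_cat; exact: tensor_catC.
- rewrite /= mul0r; exact: tensor_0.
- rewrite /= mulrDl; exact: tensor_Dl.
- rewrite /= mulrDl; exact: tensor_Dr.
- rewrite /= -!mulrA; exact: tensor_balanced.
Qed.

Fact tensor_mulP s s' t :
  tensor_eq s s' -> tensor_eq (tensor_mul s t) (tensor_mul s' t).
Proof.
move=> ss'; elim: t => [|y t IH].
  rewrite /tensor_mul !allpairs0r; exact: tensor_refl.
have mul_cons r : tensor_eq (tensor_mul r (y :: t))
    (tensor_mul r [:: y] ++ tensor_mul r t).
  by apply: tensor_perm; rewrite -cat1s; exact/permPl/perm_allpairs_catr.
apply: tensor_trans (mul_cons _) (tensor_trans _ (tensor_sym (mul_cons _))).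
by apply: tensor_cat => //; exact: tensor_mul1P.
Qed.

Fact tensor_mulC s t : tensor_eq (tensor_mul s t) (tensor_mul t s).
Proof.
apply: tensor_perm; elim: s => [|x s IH]; first by rewrite /tensor_mul allpairs0r.
rewrite perm_sym; apply: perm_trans (_ : perm_eq (tensor_mul t [:: x] ++ tensor_mul t s) _).
  by rewrite -cat1s; exact/permPl/perm_allpairs_catr.
apply: perm_cat; last by rewrite perm_sym.
rewrite /tensor_mul allpairs1r; rewrite -(@eq_map _ _ (fun y => (x.1 * y.1, x.2 * y.2))) //.
by move=> y; rewrite mulrC [x.2 * _]mulrC.
Qed.

Program Definition tensor_setoid : ring_setoid :=
  @RingSetoid (seq (B * C)) tensor_eq [::] [:: (1, 1)] tensor_opp cat tensor_mul
    tensor_refl tensor_sym tensor_trans tensor_oppP _ tensor_mulP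
    _ tensor_catC _ _ _ tensor_mulC _ _.
Next Obligation. by move=> s s' t ss'; apply: tensor_cat => //; exact: tensor_refl. Qed.
Next Obligation. by move=> s t r; rewrite catA; exact: tensor_refl. Qed.
Next Obligation. exact: tensor_refl. Qed.
Next Obligation.
elim=> [|[b c] s IH]; first exact: tensor_refl.
apply: tensor_trans (_ : tensor_eq ([:: (- b, c); (b, c)] ++ (tensor_opp s ++ s)) _).
  apply: tensor_perm; rewrite /= perm_cons -[(b, c) :: s]cat1s.
  by rewrite -[(b, c) :: _]cat1s perm_catCA.
rewrite -[X in tensor_eq _ X]cats0; apply: tensor_cat IH.
apply: tensor_trans (tensor_sym (tensor_Dl _ _ _)) _.
by rewrite addNr; exact: tensor_0.
Qed.
Next Obligation.
move=> s t r; suff -> : tensor_mul s (tensor_mul t r) = tensor_mul (tensor_mul s t) r.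
  exact: tensor_refl.
elim: s => // x s IH; rewrite /tensor_mul !allpairs_cons -!/(tensor_mul _ _) IH.
rewrite [RHS]allpairs_cat; congr (_ ++ _).
by rewrite /tensor_mul map_allpairs allpairs_mapl; apply: eq_allpairs => y z /=; rewrite !mulrA.
Qed.
Next Obligation.
move=> s; rewrite /tensor_mul allpairs1l.
rewrite (_ : map _ _ = s); first exact: tensor_refl.
by rewrite -[RHS]map_id; apply: eq_map => -[b c] /=; rewrite !mul1r.
Qed.
Next Obligation. move=> s t r; rewrite /tensor_mul allpairs_cat; exact: tensor_refl. Qed.

Definition tensor : comPzRingType := rs_quot tensor_setoid.

Definition pure_tensor (b : B) (c : C) : tensor :=
  @rs_class tensor_setoid [:: (b, c)].

Definition tensor_inl (b : B) : tensor := pure_tensor b 1.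
Definition tensor_inr (c : C) : tensor := pure_tensor 1 c.

Lemma pure_tensorDl b b' c :
  pure_tensor (b + b') c = pure_tensor b c + pure_tensor b' c.
Proof.
rewrite -[RHS](@rs_classD tensor_setoid).
exact/(@rs_classP tensor_setoid)/tensor_Dl.
Qed.

Lemma pure_tensorDr b c c' :
  pure_tensor b (c + c') = pure_tensor b c + pure_tensor b c'.
Proof.
rewrite -[RHS](@rs_classD tensor_setoid).
exact/(@rs_classP tensor_setoid)/tensor_Dr.
Qed.

Lemma pure_tensor_balanced a b c : pure_tensor (u a * b) c = pure_tensor b (v a * c).
Proof. exact/(@rs_classP tensor_setoid)/tensor_balanced. Qed.

Lemma pure_tensorM b b' c c' :
  pure_tensor b c * pure_tensor b' c' = pure_tensor (b * b') (c * c').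
Proof. by rewrite -[LHS](@rs_classM tensor_setoid). Qed.

Lemma tensor_inl_is_zmod : zmod_morphism tensor_inl.
Proof.
move=> x y; apply: (addIr (tensor_inl y)).
by rewrite /tensor_inl -pure_tensorDl !subrK.
Qed.
Lemma tensor_inl_is_monoid : monoid_morphism tensor_inl.
Proof. by split=> // x y; rewrite pure_tensorM mulr1. Qed.
Lemma tensor_inr_is_zmod : zmod_morphism tensor_inr.
Proof.
move=> x y; apply: (addIr (tensor_inr y)).
by rewrite /tensor_inr -pure_tensorDr !subrK.
Qed.
Lemma tensor_inr_is_monoid : monoid_morphism tensor_inr.
Proof. by split=> // x y; rewrite pure_tensorM mulr1. Qed.

HB.instance Definition _ :=
  GRing.isZmodMorphism.Build B tensor tensor_inl tensor_inl_is_zmod.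
HB.instance Definition _ :=
  GRing.isMonoidMorphism.Build B tensor tensor_inl tensor_inl_is_monoid.
HB.instance Definition _ :=
  GRing.isZmodMorphism.Build C tensor tensor_inr tensor_inr_is_zmod.
HB.instance Definition _ :=
  GRing.isMonoidMorphism.Build C tensor tensor_inr tensor_inr_is_monoid.

Lemma tensor_comm a : tensor_inl (u a) = tensor_inr (v a).
Proof.
by rewrite /tensor_inl -[u a]mulr1 pure_tensor_balanced /tensor_inr mulr1.
Qed.

Lemma tensor_sum (x : tensor) :
  exists s : seq (B * C), x = \sum_(y <- s) pure_tensor y.1 y.2.
Proof.
elim/rs_quotP: x => s; exists s; elim: s => [|[b c] s IH]; first by rewrite big_nil.
by rewrite big_cons -IH -[RHS](@rs_classD tensor_setoid).
Qed.

Lemma tensor_lift (R : comPzRingType) (f : {rmorphism B -> R})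
    (g : {rmorphism C -> R}) : (forall a, f (u a) = g (v a)) ->
  exists2 h : {rmorphism tensor -> R},
    forall b c, h (pure_tensor b c) = f b * g c &
    forall k : {rmorphism tensor -> R},
      (forall b c, k (pure_tensor b c) = f b * g c) -> k =1 h.
Proof.
move=> fg; pose ev (s : seq (B * C)) := \sum_(y <- s) f y.1 * g y.2.
have evP s t : tensor_eq s t -> ev s = ev t.
  rewrite /ev; elim=> {s t} [//|//|t s r _ -> _ -> //|s s' t t' _ e _ e'|s t|c
    |b b' c|b c c'|a b c]; rewrite ?big_cat /= ?big_cons ?big_nil /= ?addr0.
  - by rewrite e e'.
  - by rewrite addrC.
  - by rewrite rmorph0 mul0r.
  - by rewrite rmorphD mulrDl.
  - by rewrite rmorphD mulrDr.
  - by rewrite !rmorphM fg mulrCA mulrA.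
pose h (x : tensor) := ev (repr x).
have hE s : h (@rs_class tensor_setoid s) = ev s by exact: (evP _ _ (@rs_repr tensor_setoid s)).
have hp b c : h (pure_tensor b c) = f b * g c by rewrite hE /ev big_seq1.
have h_zmod : zmod_morphism h.
  suff hD x y : h (x + y) = h x + h y.
    by move=> x y; apply: (addIr (h y)); rewrite -hD !subrK.
  elim/rs_quotP: x => s; elim/rs_quotP: y => t.
  by rewrite -[_ + _](@rs_classD tensor_setoid) !hE /ev big_cat.
have h_monoid : monoid_morphism h.
  split=> [|x y]; first by rewrite [LHS]hp !rmorph1 mulr1.
  elim/rs_quotP: x => s; elim/rs_quotP: y => t.
  rewrite -[_ * _](@rs_classM tensor_setoid) !hE /ev big_allpairs_dep /=.
  rewrite big_distrl /=; apply: eq_bigr => x _; rewrite big_distrr /=.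
  by apply: eq_bigr => y _; rewrite !rmorphM mulrACA.
pose hz := GRing.isZmodMorphism.Build _ _ h h_zmod.
pose hm := GRing.isMonoidMorphism.Build _ _ h h_monoid.
pose H : {rmorphism tensor -> R} := HB.pack h hz hm.
exists H => // k kp x; have [s ->] := tensor_sum x.
by rewrite !rmorph_sum; apply: eq_bigr => y _; rewrite kp; exact/esym/hp.
Qed.
End Tensor.

Section Polynomials.
Variable R : comPzRingType.

(* Coefficient sequences with finite support. *)
Definition pzpoly :=
  {f : nat -> R | `[< exists n, forall i, (n <= i)%N -> f i = 0 >]}.

HB.instance Definition _ := Choice.on pzpoly.

Definition pzcoef (p : pzpoly) : nat -> R := val p.

Lemma pzcoef_bound p : exists n, forall i, (n <= i)%N -> pzcoef p i = 0.
Proof. exact/asboolP/(valP p). Qed.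

Lemma pzpolyP p q : pzcoef p =1 pzcoef q -> p = q.
Proof. by move=> pq; apply/val_inj/funext. Qed.

Definition pzpoly_mk (f : nat -> R) (fP : exists n, forall i, (n <= i)%N -> f i = 0) : pzpoly :=
  exist _ f (asboolT fP).

Fact pzpoly_zeroP : exists n, forall i, (n <= i)%N -> (fun=> 0 : R) i = 0.
Proof. by exists 0%N. Qed.
Fact pzpoly_oneP : exists n, forall i, (n <= i)%N -> (fun i => (i == 0%N)%:R : R) i = 0.
Proof. by exists 1%N => -[]. Qed.
Fact pzpoly_oppP p : exists n, forall i, (n <= i)%N -> (fun i => - pzcoef p i) i = 0.
Proof.
by have [n pn] := pzcoef_bound p; exists n => i ni; rewrite pn // oppr0.
Qed.
Fact pzpoly_addP p q :
  exists n, forall i, (n <= i)%N -> (fun i => pzcoef p i + pzcoef q i) i = 0.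
Proof.
have [n pn] := pzcoef_bound p; have [m qm] := pzcoef_bound q.
by exists (maxn n m) => i; rewrite geq_max => /andP[ni mi]; rewrite pn ?qm ?addr0.
Qed.
Fact pzpoly_mulP p q : exists n, forall i, (n <= i)%N ->
  (fun i => \sum_(j < i.+1) pzcoef p j * pzcoef q (i - j)) i = 0.
Proof.
have [n pn] := pzcoef_bound p; have [m qm] := pzcoef_bound q.
exists (n + m)%N => i nmi; rewrite big1 // => j _.
have [nj|jn] := leqP n j; first by rewrite pn // mul0r.
rewrite qm ?mulr0 // leq_subRL; last by rewrite -ltnS.
by apply: leq_trans nmi; rewrite leq_add2r ltnW.
Qed.

Definition pzpoly_zero := pzpoly_mk pzpoly_zeroP.
Definition pzpoly_one := pzpoly_mk pzpoly_oneP.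
Definition pzpoly_opp p := pzpoly_mk (pzpoly_oppP p).
Definition pzpoly_add p q := pzpoly_mk (pzpoly_addP p q).
Definition pzpoly_mul p q := pzpoly_mk (pzpoly_mulP p q).

Fact pzpoly_addA : associative pzpoly_add.
Proof. by move=> p q r; apply: pzpolyP => i; exact: addrA. Qed.
Fact pzpoly_addC : commutative pzpoly_add.
Proof. by move=> p q; apply: pzpolyP => i; exact: addrC. Qed.
Fact pzpoly_add0 : left_id pzpoly_zero pzpoly_add.
Proof. by move=> p; apply: pzpolyP => i; exact: add0r. Qed.
Fact pzpoly_addN : left_inverse pzpoly_zero pzpoly_opp pzpoly_add.
Proof. by move=> p; apply: pzpolyP => i; exact: addNr. Qed.

HB.instance Definition _ := GRing.isZmodule.Build pzpoly pzpoly_addA pzpoly_addC pzpoly_add0 pzpoly_addN.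

Fact pzpoly_mul_rev p q i : pzcoef (pzpoly_mul p q) i =
  \sum_(j < i.+1) pzcoef p (i - j)%N * pzcoef q j.
Proof.
rewrite /pzcoef /= (reindex_inj rev_ord_inj) /=.
by apply: eq_bigr => j _; rewrite (sub_ordK j).
Qed.

Fact pzpoly_mulA : associative pzpoly_mul.
Proof.
move=> p q r; apply: pzpolyP => i; rewrite [RHS]pzpoly_mul_rev.
pose coef3 j k := pzcoef p j * (pzcoef q (i - j - k)%N * pzcoef r k).
transitivity (\sum_(j < i.+1) \sum_(k < i.+1 | (k <= i - j)%N) coef3 j k).
  apply: eq_bigr => /= j _; rewrite pzpoly_mul_rev big_distrr /=.
  by rewrite (big_ord_narrow_leq (leq_subr _ _)).
rewrite (exchange_big_dep predT) //=; apply: eq_bigr => k _.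
transitivity (\sum_(j < i.+1 | (j <= i - k)%N) coef3 j k).
  apply: eq_bigl => j; rewrite -ltnS -(ltnS j) -!subSn ?leq_ord //.
  by rewrite -subn_gt0 -(subn_gt0 j) -!subnDA addnC.
rewrite (big_ord_narrow_leq (leq_subr _ _)) [pzcoef (pzpoly_mul _ _) _]/= big_distrl /=.
by apply: eq_bigr => j _; rewrite /coef3 -!subnDA addnC mulrA.
Qed.
Fact pzpoly_mulC : commutative pzpoly_mul.
Proof.
move=> p q; apply: pzpolyP => i; rewrite [RHS]pzpoly_mul_rev.
by apply: eq_bigr => j _; exact: mulrC.
Qed.
Fact pzpoly_mul1 : left_id pzpoly_one pzpoly_mul.
Proof.
move=> p; apply: pzpolyP => i; rewrite [LHS]big_ord_recl /= subn0.
rewrite /pzcoef /= mul1r big1 ?addr0 // => j _; exact: mul0r.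
Qed.
Fact pzpoly_mulD : left_distributive pzpoly_mul (@GRing.add pzpoly).
Proof.
move=> p q r; apply: pzpolyP => i; rewrite [RHS]/= -[RHS]big_split /=.
by apply: eq_bigr => j _; exact: mulrDl.
Qed.

HB.instance Definition _ :=
  GRing.Zmodule_isComPzRing.Build pzpoly pzpoly_mulA pzpoly_mulC pzpoly_mul1 pzpoly_mulD.

End Polynomials.

Section PolynomialMap.
Variables (R S : comPzRingType) (u : {rmorphism R -> S}).

Fact pzpoly_map_finite (p : pzpoly R) : `[< exists n, forall i, (n <= i)%N -> u (pzcoef p i) = 0 >].
Proof.
apply/asboolP; have [n pn] := pzcoef_bound p.
by exists n => i ni; rewrite pn // rmorph0.
Qed.

Definition pzpoly_map (p : pzpoly R) : pzpoly S :=
  exist _ (fun i => u (pzcoef p i)) (pzpoly_map_finite p).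

Lemma pzpoly_map_is_zmod : zmod_morphism pzpoly_map.
Proof. by move=> p q; apply: pzpolyP => i; exact: rmorphB. Qed.
Lemma pzpoly_map_is_monoid : monoid_morphism pzpoly_map.
Proof.
split=> [|p q]; apply: pzpolyP => i; first exact: rmorph_nat.
by rewrite [LHS]rmorph_sum; apply: eq_bigr => j _; exact: rmorphM.
Qed.

HB.instance Definition _ :=
  GRing.isZmodMorphism.Build (pzpoly R) (pzpoly S) pzpoly_map pzpoly_map_is_zmod.
HB.instance Definition _ :=
  GRing.isMonoidMorphism.Build (pzpoly R) (pzpoly S) pzpoly_map
    pzpoly_map_is_monoid.

End PolynomialMap.

(* A-prime ideals of B, relative to [u : A -> B]. *)
Definition base_prime (A B : comPzRingType) (u : {rmorphism A -> B})
    (I : set B) : Prop :=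
  is_proper_ideal I /\ forall a b, I (u a * b) -> I (u a) \/ I b.

Definition PSI_morphism (A B : comPzRingType) (u : {rmorphism A -> B}) : Prop :=
  forall I : set B, base_prime u I -> is_prime_ideal I.

(* The canonical map k(P) -> k(P) (x)_A B is a ring morphism, so being an
   isomorphism amounts to being bijective. *)
Definition strong_PSI_morphism (A B : comPzRingType) (u : {rmorphism A -> B}) :
    Prop :=
  forall P : spectrum A,
    (exists x : tensor (residue_map P) u, x <> 0) ->
    bijective (tensor_inl (residue_map P) u).

(* Main.v *)
Require Import Defs.
From HB Require Import structures.
From mathcomp Require Import all_boot ssralg poly polydiv ring.
From mathcomp Require Import boolp classical_sets.

(** The condition on a fiber says that, once k(P) (x)_A B is nonzero, it has
    no more elements than k(P); since k(P) is a field, only surjectivity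
    matters ([fiber_bijective]), and it suffices that each 1 (x) b comes from
    k(P).

    This is stable under base change: a prime Q of C lies over a prime P of A,
    the ring k(P) (x)_A B maps to k(Q) (x)_C (C (x)_A B), and the latter is
    generated over k(Q) by the image of B, hence by the image of k(P)
    ([strong_PSI_base_change]).

    A strong PSI-morphism is a PSI-morphism: if I is A-prime and P is its
    preimage in A, the elements of A outside P act injectively on B/I, so that
    B/I embeds in its ring of fractions with these denominators.  That ring is
    nonzero and receives k(P) (x)_A B, so every b in B satisfies
    u(s) b = u(a) modulo I for some a and some s outside P; primality of I thus
    reduces to that of P ([strong_PSI_is_PSI]).

    The polynomial morphism is a base change, B[X] being a quotient of
    B (x)_A A[X] ([tensor_pzpoly]).

    Suppose finally that A[X] -> B[X] is PSI and that K = k(P) (x)_A B is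
    nonzero; write k = k(P).  Clearing denominators shows that k[X] -> K[X] is
    PSI ([PSI_poly_fiber]).  Three k[X]-prime ideals of K[X] then force k = K.
    The polynomials vanishing at 0 form a k[X]-prime ideal, whose primality
    makes K a domain.  If b in K were transcendental over k, the polynomials
    vanishing at b together with their derivative would form a k[X]-prime
    ideal, which is not prime as it contains (X - b)^2 but not X - b.  So b has
    a minimal polynomial m over k; the ideal m K[X] is k[X]-prime because m
    generates a maximal ideal of k[X], hence it is prime, and the factor X - b
    of m forces m to have degree one: b is in k ([poly_PSI_surj]). *)

Set Implicit Arguments.
Unset Strict Implicit.
Unset Printing Implicit Defensive.

Import GRing.Theory.
Local Open Scope ring_scope.
Local Open Scope classical_set_scope.
Local Obligation Tactic := idtac.

(** * Ideals and the transfer of the PSI property *)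

Section IdealFacts.
Variables (R : comPzRingType).

Lemma proper_ideal1 (I : set R) : is_proper_ideal I -> ~ I 1.
Proof.
case=> -[_ _ IM] IT I1; apply: IT; apply/seteqP; split=> // x _.
by rewrite -[x]mulr1; exact: IM.
Qed.

Lemma ideal_proper (I : set R) : is_ideal I -> ~ I 1 -> is_proper_ideal I.
Proof. by move=> iI I1; split=> // IT; apply: I1; rewrite IT. Qed.

Lemma regular_unit (s t x : R) : t * s = 1 -> s * x = 0 -> x = 0.
Proof. by move=> ts sx; rewrite -[x]mul1r -ts -mulrA sx mulr0. Qed.
End IdealFacts.

Lemma ideal_preimage (R S : comPzRingType) (f : {rmorphism R -> S})
  (I : set S) : is_ideal I -> is_ideal (f @^-1` I).
Proof.
move=> iI; split=> [|x y|a x]; rewrite /preimage /= ?rmorph0 ?rmorphD ?rmorphM.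
- exact: is_ideal0.
- exact: is_idealD.
- exact: is_idealM.
Qed.

Lemma proper_ideal_preimage (R S : comPzRingType) (f : {rmorphism R -> S})
  (I : set S) : is_proper_ideal I -> is_proper_ideal (f @^-1` I).
Proof.
move=> pI; apply: ideal_proper; first exact: ideal_preimage pI.1.
by rewrite /preimage /= rmorph1; exact: proper_ideal1.
Qed.

Lemma prime_ideal_preimage (R S : comPzRingType) (f : {rmorphism R -> S})
  (I : set S) : is_prime_ideal I -> is_prime_ideal (f @^-1` I).
Proof.
case=> pI pr; split; first exact: proper_ideal_preimage.
by move=> a b; rewrite /preimage /= rmorphM; exact: pr.
Qed.

Lemma base_prime_preimage (A B : comPzRingType) (u : {rmorphism A -> B})
  (I : set B) : base_prime u I -> is_prime_ideal (u @^-1` I).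
Proof.
case=> pI pr; split; first exact: proper_ideal_preimage.
by move=> a b; rewrite /preimage /= rmorphM; exact: pr.
Qed.

(** The PSI property passes to a target each of whose elements comes from the
    source up to a unit of the base: such a unit is outside every proper
    ideal, so it can be cancelled modulo a base-prime one, and an ideal is
    determined by its preimage. *)
Lemma PSI_transfer (A B A' B' : comPzRingType)
    (u : {rmorphism A -> B}) (u' : {rmorphism A' -> B'})
    (f : {rmorphism A -> A'}) (g : {rmorphism B -> B'}) :
  (forall a, g (u a) = u' (f a)) ->
  (forall y, exists s b t, t * u' (f s) = 1 /\ u' (f s) * y = g b) ->
  PSI_morphism u -> PSI_morphism u'.
Proof.
move=> gu frac psi J [pJ bJ].
have [_ prJ] : is_prime_ideal (g @^-1` J).
  apply: psi; split; first exact: proper_ideal_preimage.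
  by move=> a b; rewrite /preimage /= rmorphM gu; exact: bJ.
have cancelJ s y t : t * u' (f s) = 1 -> J (u' (f s) * y) -> J y.
  move=> ts /bJ[Js|//]; case: (proper_ideal1 pJ).
  by rewrite -ts; exact: is_idealM pJ.1 _ _ Js.
split=> // x y Jxy.
have [s [b [s' [us sb]]]] := frac x; have [t [c [t' [ut tc]]]] := frac y.
have /prJ : (g @^-1` J) (b * c).
  rewrite /preimage /= rmorphM -sb -tc mulrACA.
  exact: is_idealM pJ.1 _ _ Jxy.
by rewrite /preimage /= -sb -tc; case; [left; apply: cancelJ us _|right; apply: cancelJ ut _].
Qed.

Lemma PSI_surjective (A B B' : comPzRingType) (u : {rmorphism A -> B})
    (u' : {rmorphism A -> B'}) (g : {rmorphism B -> B'}) :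
  (forall a, g (u a) = u' a) -> (forall y, exists x, g x = y) ->
  PSI_morphism u -> PSI_morphism u'.
Proof.
move=> gu surj; apply: (@PSI_transfer _ _ _ _ u u' idfun g) => // y.
by have [x <-] := surj y; exists 1, x, 1; rewrite /= !rmorph1 !mul1r.
Qed.

(** * Residue fields *)

Section ResidueField.
Variables (A : comPzRingType) (P : spectrum A).
Let iP : is_ideal P := (spectrumP P).1.1.

Lemma loc_mapV s : ~ spectrum_set P s -> exists t, t * loc_map P s = 1.
Proof.
move=> sP; exists (@rs_class (localization_setoid P) (frac 1 sP)).
rewrite -[LHS](@rs_classM (localization_setoid P)).
by apply/rs_classP/frac_eqE; rewrite !fracE; ring.
Qed.

Lemma loc_frac (x : localization P) :
  exists a s, ~ spectrum_set P s /\ loc_map P s * x = loc_map P a.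
Proof.
elim/rs_quotP: x => x; exists (num x), (den x); split; first exact: denP.
rewrite -[LHS](@rs_classM (localization_setoid P)).
by apply/rs_classP/frac_eqE; rewrite !fracE; ring.
Qed.

Lemma residue_mapV s : ~ spectrum_set P s -> exists t, t * residue_map P s = 1.
Proof.
move=> /loc_mapV[t ts].
exists (quotient_proj (ideal_span_ideal (loc_map P @` P)) t).
by rewrite -rmorphM ts rmorph1.
Qed.

Lemma residue_frac (x : residue_field P) :
  exists a s, ~ spectrum_set P s /\ residue_map P s * x = residue_map P a.
Proof.
elim/rs_quotP: x => x; have [a [s [sP e]]] := loc_frac x.
by exists a, s; split=> //; rewrite /residue_map /= -e rmorphM.
Qed.

(** The span of the image of P in the localization consists of fractions with
    numerator in P, and a fraction equal to such a one has numerator in P. *)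
Lemma residue_map_eq0 a : residue_map P a = 0 <-> spectrum_set P a.
Proof.
have [_ prP] := spectrumP P.
pose proj := quotient_proj (ideal_span_ideal (loc_map P @` P)).
have -> : residue_map P a = 0 <-> @loc_ideal _ P (loc_map P a).
  rewrite -[X in loc_ideal X]subr0 -(rmorph0 proj).
  exact: (@rs_classP (quotient_setoid (ideal_span_ideal (loc_map P @` P)))).
split=> [h|Pa]; last by move=> I iI; apply; exists a.
pose M : set (localization P) := [set x | exists a s,
  [/\ spectrum_set P a, ~ spectrum_set P s & loc_map P s * x = loc_map P a]].
have iM : is_ideal M.
  split=> [|x y [b [s [Pb Ps e]]] [c [t [Pc Pt f]]]|x y [b [s [Pb Ps e]]]].
  - exists 0, 1; split; [exact: is_ideal0|exact: spectrum1|].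
    by rewrite mulr0 rmorph0.
  - exists (t * b + s * c), (s * t); split; last 1 first.
    + by rewrite rmorphD !rmorphM /= -e -f; ring.
    + by apply: is_idealD => //; exact: is_idealM.
    + exact: spectrumM.
  - have [c [t [Pt f]]] := loc_frac x.
    exists (c * b), (t * s); split; last 1 first.
    + by rewrite !rmorphM /= -e -f; ring.
    + exact: is_idealM.
    + exact: spectrumM.
have [|b [s [Pb Ps e]]] := h M iM.
  move=> _ [b Pb <-]; exists b, 1; split=> //; first exact: spectrum1.
  by rewrite rmorph1 mul1r.
move: e; rewrite -rmorphM => /(@rs_classP (localization_setoid P))[t Pt].
rewrite !fracE !mulr1 => e.
have : spectrum_set P (t * s * a) by rewrite -mulrA e; exact: is_idealM.
by move=> /prP[/prP[]|].
Qed.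

Lemma residue_field1_neq0 : (1 : residue_field P) <> 0.
Proof.
by rewrite -(rmorph1 (residue_map P)) => /residue_map_eq0; exact: spectrum1.
Qed.

Lemma residue_fieldV (x : residue_field P) : x <> 0 -> exists y, y * x = 1.
Proof.
move=> x0; have [a [s [Ps e]]] := residue_frac x.
have [t ts] := residue_mapV Ps.
have /residue_mapV[r ra] : ~ spectrum_set P a.
  by move=> /residue_map_eq0 a0; apply/x0/(regular_unit ts); rewrite e a0.
by exists (r * residue_map P s); rewrite -mulrA e.
Qed.

(** Universal property of A -> k(P): it is initial among the morphisms that
    kill P and invert the complement of P.  The lift is built as a functional
    relation, which avoids descending through the localization and the
    quotient in turn. *)
Lemma residue_lift (R : comPzRingType) (f : {rmorphism A -> R}) :
  (forall a, spectrum_set P a -> f a = 0) ->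
  (forall s, ~ spectrum_set P s -> exists t, t * f s = 1) ->
  exists h : {rmorphism residue_field P -> R}, forall a, h (residue_map P a) = f a.
Proof.
move=> fP fV.
pose graph x y := exists a s,
  [/\ ~ spectrum_set P s, residue_map P s * x = residue_map P a & f s * y = f a].
have total x : {y | graph x y}.
  apply: cid; have [a [s [Ps e]]] := residue_frac x.
  have [t ts] := fV _ Ps; exists (t * f a); exists a, s; split=> //.
  by rewrite mulrA [f s * t]mulrC ts mul1r.
have functional x y z : graph x y -> graph x z -> y = z.
  move=> [a [s [Ps e1 e2]]] [b [r [Pr d1 d2]]].
  have /fV[t] := spectrumM Ps Pr; rewrite rmorphM => tsr.
  apply/subr0_eq/(regular_unit tsr).
  transitivity (f (r * a - s * b)).
    by rewrite rmorphB !rmorphM -e2 -d2; ring.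
  by apply/fP/residue_map_eq0; rewrite rmorphB !rmorphM -e1 -d1; ring.
pose h x := sval (total x).
have hP x : graph x (h x) := svalP (total x).
have hE a : h (residue_map P a) = f a.
  apply: functional (hP _) _; exists a, 1; split; first exact: spectrum1.
  - by rewrite rmorph1 mul1r.
  - by rewrite rmorph1 mul1r.
have h_zmod : zmod_morphism h.
  move=> x y; apply: functional (hP _) _.
  have [a [s [Ps e1 e2]]] := hP x; have [b [r [Pr d1 d2]]] := hP y.
  exists (r * a - s * b), (s * r); split; first exact: spectrumM.
  - by rewrite rmorphB !rmorphM -e1 -d1; ring.
  - by rewrite rmorphB !rmorphM -e2 -d2; ring.
have h_monoid : monoid_morphism h.
  split=> [|x y]; first by rewrite -(rmorph1 (residue_map P)) hE rmorph1.
  apply: functional (hP _) _.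
  have [a [s [Ps e1 e2]]] := hP x; have [b [r [Pr d1 d2]]] := hP y.
  exists (a * b), (s * r); split; first exact: spectrumM.
  - by rewrite !rmorphM -e1 -d1; ring.
  - by rewrite !rmorphM -e2 -d2; ring.
pose hz := GRing.isZmodMorphism.Build _ _ h h_zmod.
pose hm := GRing.isMonoidMorphism.Build _ _ h h_monoid.
pose H : {rmorphism residue_field P -> R} := HB.pack h hz hm.
by exists H.
Qed.

End ResidueField.

(** * Tensor products and fibers *)

Lemma pure_tensorE (A B C : comPzRingType) (u : {rmorphism A -> B})
    (v : {rmorphism A -> C}) b c :
  pure_tensor u v b c = tensor_inl u v b * tensor_inr u v c.
Proof. by rewrite pure_tensorM mulr1 mul1r. Qed.

Lemma tensor_inl_surj (A B C : comPzRingType) (u : {rmorphism A -> B})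
    (v : {rmorphism A -> C}) :
  (forall c, exists b, tensor_inl u v b = tensor_inr u v c) ->
  forall x, exists b, tensor_inl u v b = x.
Proof.
move=> surj x; have [s ->] := tensor_sum x.
elim: s => [|[b c] s [d IH]]; first by exists 0; rewrite rmorph0 big_nil.
have [b' e] := surj c; exists (b * b' + d).
by rewrite big_cons pure_tensorE rmorphD rmorphM /= IH e.
Qed.

(** Injectivity is automatic, because a field has no proper nonzero ideal and
    the target is nonzero. *)
Lemma fiber_bijective (A B : comPzRingType) (u : {rmorphism A -> B})
    (P : spectrum A) :
  (exists x : tensor (residue_map P) u, x <> 0) ->
  (forall b, exists q, tensor_inl (residue_map P) u q = tensor_inr (residue_map P) u b) ->
  bijective (tensor_inl (residue_map P) u).
Proof.
move=> [x x0] surj.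
have inj : injective (tensor_inl (residue_map P) u).
  apply: raddf_inj => q q0; apply: contrapT => /residue_fieldV[r rq].
  by apply: x0; rewrite -[x]mul1r -(rmorph1 (tensor_inl _ _)) -rq rmorphM q0 mulr0 mul0r.
pose inv y := sval (cid (tensor_inl_surj surj y)).
have invK y : tensor_inl (residue_map P) u (inv y) = y .
  by rewrite /inv; case: cid.
by exists inv => // q; apply: inj; rewrite invK.
Qed.

(** * Base change of strong PSI-morphisms *)

Lemma strong_PSI_base_change (A B C : comPzRingType) (u : {rmorphism A -> B})
    (v : {rmorphism A -> C}) :
  strong_PSI_morphism u -> strong_PSI_morphism (tensor_inl v u : {rmorphism C -> tensor v u}).
Proof.
move=> spsi Q T0; apply: (fiber_bijective T0).
pose u' : {rmorphism C -> tensor v u} := tensor_inl v u.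
pose inlT : {rmorphism residue_field Q -> tensor (residue_map Q) u'} :=
  tensor_inl (residue_map Q) u'.
pose inrT : {rmorphism tensor v u -> tensor (residue_map Q) u'} :=
  tensor_inr (residue_map Q) u'.
rewrite -/u' -/inlT -/inrT in T0 *.
pose P := Spectrum (prime_ideal_preimage v (spectrumP Q)).
have [||i iE] := @residue_lift _ P _ (residue_map Q \o v).
- by move=> a Pa; apply/residue_map_eq0.
- by move=> s Ps; exact: residue_mapV.
have [|j jE _] := @tensor_lift _ _ _ (residue_map P) u _
  (inlT \o i) (inrT \o tensor_inr v u).
  by move=> a; rewrite /= iE -tensor_comm; exact: tensor_comm.
have T1 : (1 : tensor (residue_map Q) u') <> 0.
  by case: T0 => x x0 T1; apply: x0; rewrite -[x]mul1r T1 mul0r.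
have [|k kK Kk] := spsi P.
  by exists 1 => e; apply: T1; rewrite -(rmorph1 j) e rmorph0.
(* The inverse [k] of k(P) -> k(P) (x) B turns 1 (x) b into an element of k(P),
   which is then sent to k(Q). *)
have inrB b : exists q, inlT q = inrT (tensor_inr v u b).
  exists (i (k (tensor_inr (residue_map P) u b))).
  have <- : j (tensor_inr (residue_map P) u b) = inrT (tensor_inr v u b).
    by rewrite jE /= !rmorph1 mul1r.
  by rewrite -[X in _ = j X]Kk jE /= rmorph1 mulr1.
move=> y; have [s ->] := tensor_sum y.
elim: s => [|[c b] s [q e]]; first by exists 0; rewrite big_nil !rmorph0.
have [r f] := inrB b; exists (residue_map Q c * r + q).
rewrite big_cons pure_tensorE (rmorphD inlT) (rmorphM inlT).
rewrite (rmorphD inrT) (rmorphM inrT); congr (_ * _ + _) => //.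
exact: tensor_comm.
Qed.

(** * Strong PSI-morphisms are PSI-morphisms *)

Section BasePrimeFractions.
Variables (A B : comPzRingType) (u : {rmorphism A -> B}) (I : set B).
Hypothesis bI : base_prime u I.
Let iI : is_ideal I := bI.1.1.

(** Representatives for the ring of fractions of B/I with denominators in
    the complement of the preimage of I in A.  As these denominators act
    injectively on B/I, equality of fractions is plain cross-multiplication
    modulo I, without the usual auxiliary multiplier. *)
Definition bp_fraction := {x : B * A | `[< ~ I (u x.2) >]}.

Definition bp_num (x : bp_fraction) : B := (val x).1.
Definition bp_den (x : bp_fraction) : B := u (val x).2.

Definition bp_frac (b : B) (s : A) (sI : ~ I (u s)) : bp_fraction :=
  exist (fun x => `[< ~ I (u x.2) >]) (b, s) (asboolT sI).

Lemma bp_denP (x : bp_fraction) : ~ I (bp_den x).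
Proof. exact/asboolP/(valP x). Qed.

Lemma bp_cancel (x : bp_fraction) b : I (bp_den x * b) -> I b.
Proof. by move=> /bI.2[/(@bp_denP x)|]. Qed.

Lemma bp_one : ~ I (u 1).
Proof. by rewrite rmorph1; exact: proper_ideal1 bI.1. Qed.

Lemma bp_mul s t : ~ I (u s) -> ~ I (u t) -> ~ I (u (s * t)).
Proof. by move=> sI tI; rewrite rmorphM => /bI.2[]. Qed.

Definition bp_eq (x y : bp_fraction) : Prop :=
  I (bp_num x * bp_den y - bp_num y * bp_den x).

Definition bp_opp (x : bp_fraction) := bp_frac (- bp_num x) (@bp_denP x).
Definition bp_add (x y : bp_fraction) :=
  bp_frac (bp_num x * bp_den y + bp_num y * bp_den x)
    (bp_mul (@bp_denP x) (@bp_denP y)).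
Definition bp_mult (x y : bp_fraction) :=
  bp_frac (bp_num x * bp_num y) (bp_mul (@bp_denP x) (@bp_denP y)).

Lemma bp_numE b s (sI : ~ I (u s)) : bp_num (bp_frac b sI) = b.
Proof. by []. Qed.
Lemma bp_denE b s (sI : ~ I (u s)) : bp_den (bp_frac b sI) = u s.
Proof. by []. Qed.
Definition bpE := (bp_numE, bp_denE, rmorphM, rmorph1).

Lemma bp_eqE x y : bp_num x * bp_den y = bp_num y * bp_den x -> bp_eq x y.
Proof. by rewrite /bp_eq => ->; rewrite subrr; exact: is_ideal0. Qed.

Lemma bp_eq_scale (x y x' y' : bp_fraction) c : bp_eq x y ->
  bp_num x' * bp_den y' - bp_num y' * bp_den x' =
    c * (bp_num x * bp_den y - bp_num y * bp_den x) -> bp_eq x' y'.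
Proof. by rewrite /bp_eq => + -> => /(is_idealM iI c). Qed.

Program Definition bp_setoid : ring_setoid :=
  @RingSetoid bp_fraction bp_eq (bp_frac 0 bp_one) (bp_frac 1 bp_one)
    bp_opp bp_add bp_mult _ _ _ _ _ _ _ _ _ _ _ _ _ _.
Next Obligation. by move=> x; exact: bp_eqE. Qed.
Next Obligation. by move=> x y /(@bp_eq_scale _ _ _ _ (- 1)); apply; ring. Qed.
Next Obligation.
move=> y x z xy yz; apply: (@bp_cancel y).
have := is_idealD iI (is_idealM iI (bp_den z) xy) (is_idealM iI (bp_den x) yz).
by congr I; ring.
Qed.
Next Obligation. by move=> x y /(@bp_eq_scale _ _ _ _ (- 1)); apply; rewrite !bpE -/(bp_den _); ring. Qed.
Next Obligation.
by move=> x x' y /(@bp_eq_scale _ _ _ _ (bp_den y * bp_den y)); apply; rewrite !bpE -!/(bp_den _); ring.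
Qed.
Next Obligation.
by move=> x x' y /(@bp_eq_scale _ _ _ _ (bp_num y * bp_den y)); apply; rewrite !bpE -!/(bp_den _); ring.
Qed.
Next Obligation. by move=> x y z; apply: bp_eqE; rewrite !bpE; ring. Qed.
Next Obligation. by move=> x y; apply: bp_eqE; rewrite !bpE; ring. Qed.
Next Obligation. by move=> x; apply: bp_eqE; rewrite !bpE; ring. Qed.
Next Obligation. by move=> x; apply: bp_eqE; rewrite !bpE; ring. Qed.
Next Obligation. by move=> x y z; apply: bp_eqE; rewrite !bpE; ring. Qed.
Next Obligation. by move=> x y; apply: bp_eqE; rewrite !bpE; ring. Qed.
Next Obligation. by move=> x; apply: bp_eqE; rewrite !bpE; ring. Qed.
Next Obligation. by move=> x y z; apply: bp_eqE; rewrite !bpE; ring. Qed.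

Definition bp_ring : comPzRingType := rs_quot bp_setoid.

Definition bp_map (b : B) : bp_ring := @rs_class bp_setoid (bp_frac b bp_one).

Lemma bp_map_is_zmod : zmod_morphism bp_map.
Proof.
move=> x y; rewrite -[- bp_map y](@rs_classN bp_setoid).
rewrite -[RHS](@rs_classD bp_setoid).
by apply/rs_classP/bp_eqE; rewrite !bpE; ring.
Qed.
Lemma bp_map_is_monoid : monoid_morphism bp_map.
Proof.
split=> // x y; rewrite -[RHS](@rs_classM bp_setoid).
by apply/rs_classP/bp_eqE; rewrite !bpE; ring.
Qed.
HB.instance Definition _ :=
  GRing.isZmodMorphism.Build B bp_ring bp_map bp_map_is_zmod.
HB.instance Definition _ :=
  GRing.isMonoidMorphism.Build B bp_ring bp_map bp_map_is_monoid.

Lemma bp_map_eq0 b : bp_map b = 0 -> I b.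
Proof.
by move=> /(@rs_classP bp_setoid); rewrite /= /bp_eq !bpE mul0r subr0 mulr1.
Qed.

Lemma bp_map0 b : I b -> bp_map b = 0.
Proof.
by move=> Ib; apply/(@rs_classP bp_setoid); rewrite /= /bp_eq !bpE mul0r subr0 mulr1.
Qed.

Lemma bp_mapV s : ~ I (u s) -> exists t, t * bp_map (u s) = 1.
Proof.
move=> sI; exists (@rs_class bp_setoid (bp_frac 1 sI)).
rewrite -[LHS](@rs_classM bp_setoid).
by apply/rs_classP/bp_eqE; rewrite !bpE; ring.
Qed.

End BasePrimeFractions.

(** Each element of B is, modulo I, a fraction u(a) / u(s) with s outside the
    preimage of I.  It is enough to see this in the ring of fractions of B/I,
    where it is the image of the same relation in k(P) (x)_A B. *)
Lemma strong_PSI_is_PSI (A B : comPzRingType) (u : {rmorphism A -> B}) :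
  strong_PSI_morphism u -> PSI_morphism u.
Proof.
move=> spsi I bI; have [pI prI] := bI; split=> //.
pose P := Spectrum (base_prime_preimage bI).
have [|| i iE] := @residue_lift _ P _ (bp_map bI \o u).
- by move=> a Pa; exact: bp_map0.
- by move=> s Ps; exact: bp_mapV.
have [a|j jE _] := @tensor_lift _ _ _ (residue_map P) u _ i (bp_map bI).
  exact: iE.
have [|k kK Kk] := spsi P.
  exists 1 => e; apply: (proper_ideal1 pI); apply: (bp_map_eq0 (bI := bI)).
  by rewrite rmorph1 -(rmorph1 j) e rmorph0.
have frac b : exists a s, ~ I (u s) /\ I (u s * b - u a).
  have [a [s [Ps e]]] := residue_frac (k (tensor_inr (residue_map P) u b)).
  exists a, s; split=> //; apply: (bp_map_eq0 (bI := bI)).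
  transitivity (i (residue_map P s) * bp_map bI b - i (residue_map P a)).
    by rewrite !iE rmorphB rmorphM.
  rewrite -e rmorphM /=.
  have -> : bp_map bI b = j (tensor_inr (residue_map P) u b).
    by rewrite jE rmorph1 mul1r.
  by rewrite -[X in j X]Kk jE rmorph1 mulr1 subrr.
have cancel s b : ~ I (u s) -> I (u s * b) -> I b by move=> sI /prI[].
have num b a s : ~ I (u s) -> I (u s * b - u a) -> I (u a) -> I b.
  move=> sI e Ia; apply: cancel sI _.
  by rewrite -[_ * b](subrK (u a)); exact: is_idealD pI.1 _ _ e Ia.
move=> x y Ixy; have [a [s [sI e]]] := frac x; have [b [t [tI f]]] := frac y.
suff /prI[Ia|Ib] : I (u a * u b) by [left; exact: num e Ia|right; exact: num f Ib].
have iI := pI.1.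
have := is_idealD iI (is_idealM iI (u s * u t) Ixy)
  (is_idealN iI (is_idealD iI (is_idealM iI (u t * y) e) (is_idealM iI (u a) f))).
by congr I; ring.
Qed.

(** * Polynomials over a field extension *)

Section PolynomialCriterion.
Variables (k : fieldType) (K : comNzRingType) (i : {rmorphism k -> K}).

Hypothesis psi : PSI_morphism (map_poly i : {rmorphism {poly k} -> {poly K}}).

(** The ideal of polynomials vanishing at 0 is k[X]-prime because the value of
    p in k[X] at 0 lies in k, hence is zero or a unit. *)
Lemma poly_PSI_domain (x y : K) : x * y = 0 -> x = 0 \/ y = 0.
Proof.
pose I : set {poly K} := [set g | g.[0] = 0].
have iI : is_ideal I.
  split=> [|g h|g h]; rewrite /I /= ?horner0 ?hornerD ?hornerM //.
    by move=> -> ->; rewrite addr0.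
  by move=> ->; rewrite mulr0.
have [|_ prI xy] := psi (I := I).
  split; first by apply: ideal_proper => //; rewrite /I /= hornerE; exact/eqP/oner_neq0.
  move=> p g; rewrite /I /= hornerM.
  have -> : (map_poly i p).[0] = i p.[0] by rewrite -(rmorph0 i) horner_map.
  have [->|p0] := eqVneq p.[0] 0; first by rewrite rmorph0; left.
  right; apply: (@regular_unit _ (i p.[0]) (i p.[0]^-1)) => //.
  by rewrite -rmorphM mulVf // rmorph1.
have /prI : I (x%:P * y%:P) by rewrite /I /= hornerM !hornerC.
by rewrite /I /= !hornerC.
Qed.

(** When no nonzero polynomial over k kills b, the values at b of nonzero
    polynomials over k are regular, and the ideal of polynomials with a double
    zero at b is k[X]-prime; but it is never prime. *)
Lemma poly_PSI_algebraic (b : K) : exists2 p, p != 0 & (map_poly i p).[b] = 0.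
Proof.
apply: contrapT => trans.
have {}trans p : (map_poly i p).[b] = 0 -> p = 0.
  by move=> pb; have [//|p0] := eqVneq p 0; case: trans; exists p.
pose I : set {poly K} := [set g | g.[b] = 0 /\ g^`().[b] = 0].
have iI : is_ideal I.
  split=> [|g h|g h]; rewrite /I /= ?deriv0 ?horner0 ?derivD ?derivM ?hornerD ?hornerM //.
    by move=> [-> ->] [-> ->]; rewrite addr0.
  by move=> [-> ->]; rewrite !mulr0 addr0.
have [|_ prI] := psi (I := I).
  split; first by apply: ideal_proper => // -[]; rewrite hornerE => /eqP; rewrite oner_eq0.
  move=> p g [].
  have [/trans-> _ _|pb] := eqVneq (map_poly i p).[b] 0.
    by left; rewrite rmorph0; exact: is_ideal0.
  rewrite derivM hornerD !hornerM.
  move=> /poly_PSI_domain[/eqP|g0]; first by rewrite (negPf pb).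
  rewrite g0 mulr0 add0r => /poly_PSI_domain[/eqP|g'0]; first by rewrite (negPf pb).
  by right; split.
have /prI : I (('X - b%:P) * ('X - b%:P)).
  by split; rewrite ?derivM ?hornerD !hornerM !hornerXsubC subrr !(mulr0, mul0r) ?addr0.
suff : ~ I ('X - b%:P) by move=> nI [].
by case=> _ /eqP; rewrite derivXsubC hornerE oner_eq0.
Qed.

Lemma poly_PSI_minpoly (b : K) : exists m : {poly k},
  [/\ m \is monic, (map_poly i m).[b] = 0 &
     forall q, (map_poly i q).[b] = 0 -> m %| q].
Proof.
pose annihilated n := `[< exists2 p : {poly k},
  (p != 0) && (size p == n) & (map_poly i p).[b] = 0 >].
have : exists n, annihilated n.
  have [p p0 pb] := poly_PSI_algebraic b.
  by exists (size p); apply/asboolP; exists p; rewrite ?p0 ?eqxx.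
move=> /ex_minnP[_ /asboolP[m /andP[m0 /eqP<-] mb] mmin].
have lm : (lead_coef m)^-1 != 0 by rewrite invr_eq0 lead_coef_eq0.
exists ((lead_coef m)^-1 *: m); split.
- by rewrite monicE lead_coefZ mulVf // lead_coef_eq0.
- by rewrite linearZ /= hornerZ mb mulr0.
move=> q qb; rewrite dvdpZl //; apply: contraT; rewrite /dvdp => r0.
have := ltn_modp q m; rewrite m0 ltnNge => /negP[]; apply: mmin.
apply/asboolP; exists (q %% m); first by rewrite r0 eqxx.
by move: qb; rewrite {1}(divp_eq q m) rmorphD rmorphM /= hornerD hornerM mb mulr0 add0r.
Qed.

(** Over k, a polynomial not vanishing at b is coprime to the minimal
    polynomial m, hence invertible modulo m: this makes m K[X] a k[X]-prime
    ideal.  Being prime, it contains X - b or the cofactor m / (X - b), and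
    comparing degrees leaves only m = X - b. *)
Lemma poly_PSI_surj (b : K) : exists a, i a = b.
Proof.
have [m [mm mb mdvd]] := poly_PSI_minpoly b.
have m0 : m != 0 := monic_neq0 mm.
have mmi : map_poly i m \is monic := monic_map i mm.
have smi : size (map_poly i m) = size m.
  by rewrite size_map_poly_id0 // (monicP mm) rmorph1 oner_neq0.
have m_gt1 : (1 < size m)%N.
  rewrite ltnNge; apply/negP => /size1_polyC e; move: mb mm; rewrite e.
  by rewrite map_polyC /= hornerC monicE lead_coefC => + /eqP m1; rewrite m1 rmorph1 => /eqP; rewrite oner_eq0.
have coprime_m q : (map_poly i q).[b] <> 0 -> coprimep q m.
  move=> qb; rewrite coprimep_def; set d := gcdp q m.
  have /dvdpP[r qE] : d %| q := dvdp_gcdl q m.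
  have /dvdpP[e mE] : d %| m := dvdp_gcdr q m.
  have [e0 d0] : e != 0 /\ d != 0.
    by apply/andP; rewrite -negb_or -mulf_eq0 -mE.
  have : (map_poly i e).[b] = 0.
    move: mb; rewrite mE rmorphM hornerM => /poly_PSI_domain[//|db].
    by case: qb; rewrite qE rmorphM hornerM db mulr0.
  (* m divides its factor e, so the complementary factor d is constant. *)
  move=> /mdvd/dvdp_leq -/(_ e0); rewrite {1}mE size_mul // -subn1 leq_subLR.
  by rewrite addnC leq_add2r; rewrite eqn_leq size_poly_gt0 d0 andbT.
pose I : set {poly K} := [set g | exists h, g = h * map_poly i m].
have sizeI g : I g -> g <> 0 -> (size m <= size g)%N.
  move=> [h ->] /eqP hm0; have h0 : h != 0.
    by apply: contra_neq hm0 => ->; rewrite mul0r.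
  rewrite size_Mmonic // smi; move: h0; rewrite -size_poly_gt0.
  by case: (size h) => // n _; rewrite addSn leq_addl.
have iI : is_ideal I.
  split=> [|_ _ [g ->] [h ->]|g _ [h ->]].
  - by exists 0; rewrite mul0r.
  - by exists (g + h); rewrite mulrDl.
  - by exists (g * h); rewrite mulrA.
have [|_ prI] := psi (I := I).
  split.
    apply: ideal_proper => // /sizeI; rewrite size_poly1 leqNgt m_gt1.
    by move=> h; have /h : (1 : {poly K}) <> 0 by exact/eqP/oner_neq0.
  move=> q g [h qg]; have [/mdvd/dvdpP[r ->]|/eqP/coprime_m] := eqVneq (map_poly i q).[b] 0.
    by left; exists (map_poly i r); rewrite rmorphM.
  move=> /Bezout_eq1_coprimepP[[c d] /= cd]; right.
  exists (map_poly i c * h + map_poly i d * g).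
  rewrite -[LHS]mul1r -(rmorph1 (map_poly i)) -cd rmorphD !rmorphM /=.
  transitivity (map_poly i c * (map_poly i q * g) + map_poly i d * map_poly i m * g); first by ring.
  by rewrite qg; ring.
have /factor_theorem[h mE] : root (map_poly i m) b by apply/eqP.
have h0 : h <> 0.
  by move=> h0; move: (monic_neq0 mmi); rewrite mE h0 mul0r eqxx.
have sh : size m = (size h).+1.
  by rewrite -smi mE size_Mmonic ?monicXsubC ?size_XsubC ?addn2 //; apply/eqP.
have /prI : I (h * ('X - b%:P)) by rewrite -mE; exists 1; rewrite mul1r.
case=> [/sizeI/(_ h0)|/sizeI]; first by rewrite sh ltnn.
rewrite size_XsubC => sm.
have {}sm : size m = 2 by apply/eqP; rewrite eqn_leq m_gt1 sm //; exact/eqP/monic_neq0/monicXsubC.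
(* A monic polynomial of degree one with root b is X - b. *)
exists (- m`_0); move: mb; rewrite horner_coef smi sm !big_ord_recl big_ord0.
rewrite !coef_map /= (_ : m`_1 = 1); last by move/monicP: mm; rewrite lead_coefE sm.
rewrite rmorph1 expr0 expr1 mulr1 mul1r addr0 rmorphN => /eqP.
by rewrite addrC addr_eq0 => /eqP.
Qed.

End PolynomialCriterion.

(** * The polynomial morphism as a base change *)

Section Monomials.
Variable R : comPzRingType.

Fact pzmono_finite (b : R) n :
  exists m, forall i, (m <= i)%N -> (fun i => if i == n then b else 0) i = 0.
Proof. by exists n.+1 => i ni; rewrite gtn_eqF. Qed.

Definition pzmono b n : pzpoly R := pzpoly_mk (pzmono_finite b n).
Definition pzconst b := pzmono b 0.

Lemma pzcoef_mono b n i : pzcoef (pzmono b n) i = if i == n then b else 0.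
Proof. by []. Qed.

Lemma pzcoefM (p q : pzpoly R) i :
  pzcoef (p * q) i = \sum_(j < i.+1) pzcoef p j * pzcoef q (i - j).
Proof. by []. Qed.

Lemma pzcoef_constM b (p : pzpoly R) i : pzcoef (pzconst b * p) i = b * pzcoef p i.
Proof.
rewrite pzcoefM big_ord_recl big1 ?addr0 ?subn0 // => j _.
by rewrite pzcoef_mono mul0r.
Qed.

Lemma pzconst_is_zmod : zmod_morphism pzconst.
Proof.
move=> x y; apply: pzpolyP => i.
rewrite -[RHS]/(pzcoef (pzconst x) i - pzcoef (pzconst y) i) !pzcoef_mono.
by case: eqP; rewrite ?subr0.
Qed.
Lemma pzconst_is_monoid : monoid_morphism pzconst.
Proof.
split=> [|x y]; apply: pzpolyP => i; first by case: i.
by rewrite pzcoef_constM !pzcoef_mono; case: eqP; rewrite ?mulr0.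
Qed.

HB.instance Definition _ :=
  GRing.isZmodMorphism.Build R (pzpoly R) pzconst pzconst_is_zmod.
HB.instance Definition _ :=
  GRing.isMonoidMorphism.Build R (pzpoly R) pzconst pzconst_is_monoid.

Lemma pzcoef_sum n (F : 'I_n -> pzpoly R) i :
  pzcoef (\sum_(j < n) F j) i = \sum_(j < n) pzcoef (F j) i.
Proof. exact: (big_morph (fun p => pzcoef p i)). Qed.

Lemma pzpoly_sum (p : pzpoly R) :
  exists n, p = \sum_(j < n) pzconst (pzcoef p j) * pzmono 1 j.
Proof.
have [n pn] := pzcoef_bound p; exists n; apply: pzpolyP => i.
rewrite pzcoef_sum; have [ni|i_n] := leqP n i.
  rewrite pn // big1 // => j _; rewrite pzcoef_constM pzcoef_mono gtn_eqF ?mulr0 //.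
  exact: leq_trans ni.
rewrite (bigD1 (Ordinal i_n)) //= pzcoef_constM pzcoef_mono eqxx mulr1.
rewrite big1 ?addr0 // => j; rewrite -val_eqE /= => ji.
by rewrite pzcoef_constM pzcoef_mono eq_sym (negPf ji) mulr0.
Qed.
End Monomials.

Lemma pzmap_mono1 (R S : comPzRingType) (u : {rmorphism R -> S}) n :
  pzpoly_map u (pzmono 1 n) = pzmono 1 n.
Proof.
apply: pzpolyP => i; rewrite -[LHS]/(u (pzcoef (pzmono 1 n) i)) !pzcoef_mono.
by case: eqP; rewrite ?rmorph1 ?rmorph0.
Qed.

Lemma pzmap_const (R S : comPzRingType) (u : {rmorphism R -> S}) a :
  pzpoly_map u (pzconst a) = pzconst (u a).
Proof.
apply: pzpolyP => i; rewrite -[LHS]/(u (pzcoef (pzmono a 0) i)) !pzcoef_mono.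
by case: eqP; rewrite ?rmorph0.
Qed.

(** The fibers carry C on the left of the tensor product and the PSI condition
    carries it on the right; this morphism passes from one to the other. *)
Lemma tensor_swap (A B C : comPzRingType) (u : {rmorphism A -> B})
    (v : {rmorphism A -> C}) :
  exists2 h : {rmorphism tensor v u -> tensor u v},
    forall c, h (tensor_inl v u c) = tensor_inr u v c & forall y, exists x, h x = y.
Proof.
have [|h hE _] := @tensor_lift _ _ _ v u _ (tensor_inr u v) (tensor_inl u v).
  by move=> a; exact/esym/tensor_comm.
exists h => [c|y]; first by rewrite hE rmorph1 mulr1.
have [s ->] := tensor_sum y; elim: s => [|[b c] s [x e]].
  by exists 0; rewrite big_nil rmorph0.
exists (pure_tensor v u c b + x).
by rewrite big_cons rmorphD hE e pure_tensorE mulrC.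
Qed.

(** Surjectivity of B (x)_A A[X] -> B[X], which is what lets the PSI property
    descend to the polynomial morphism, holds because b X^j is the image of
    b (x) X^j. *)
Lemma tensor_pzpoly (A B : comPzRingType) (u : {rmorphism A -> B}) :
  exists2 h : {rmorphism tensor u (@pzconst A : {rmorphism A -> pzpoly A}) -> pzpoly B},
    forall p, h (tensor_inr u (@pzconst A : {rmorphism A -> pzpoly A}) p) = pzpoly_map u p &
    forall q, exists x, h x = q.
Proof.
pose c : {rmorphism A -> pzpoly A} := @pzconst A.
have [a|h hE _] := @tensor_lift _ _ _ u c _ (@pzconst B) (pzpoly_map u).
  exact/esym/pzmap_const.
exists h => [p|q]; first by rewrite hE rmorph1 mul1r.
have [n ->] := pzpoly_sum q.
exists (\sum_(j < n) pure_tensor u c (pzcoef q j) (pzmono 1 j)).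
by rewrite rmorph_sum; apply: eq_bigr => j _; rewrite hE /= pzmap_mono1.
Qed.

(** * From the polynomial morphism to the fibers *)

Section PolynomialOfPzpoly.
Variables (R : comPzRingType) (S : comNzRingType) (f : {rmorphism R -> S}).

(** The comparison A[X] -> k[X]; polynomials over a nonzero ring are taken as
    [{poly S}] so that Euclidean division is at hand. *)
Definition poly_of (p : pzpoly R) : {poly S} :=
  \poly_(i < sval (cid (pzcoef_bound p))) f (pzcoef p i).

Lemma coef_poly_of p i : (poly_of p)`_i = f (pzcoef p i).
Proof.
rewrite coef_poly; case: cid => n pn /=; case: ltnP => // /pn->.
by rewrite rmorph0.
Qed.

Lemma poly_of_is_zmod : zmod_morphism poly_of.
Proof.
by move=> p q; apply/polyP => i; rewrite coefB !coef_poly_of -rmorphB.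
Qed.
Lemma poly_of_is_monoid : monoid_morphism poly_of.
Proof.
split=> [|p q]; apply/polyP => i; rewrite coef_poly_of ?coef1 ?coefM.
  exact: rmorph_nat.
by rewrite pzcoefM rmorph_sum; apply: eq_bigr => j _; rewrite rmorphM !coef_poly_of.
Qed.

HB.instance Definition _ :=
  GRing.isZmodMorphism.Build (pzpoly R) {poly S} poly_of poly_of_is_zmod.
HB.instance Definition _ :=
  GRing.isMonoidMorphism.Build (pzpoly R) {poly S} poly_of poly_of_is_monoid.

Lemma poly_of_mono b n : poly_of (pzmono b n) = f b *: 'X^n.
Proof.
apply/polyP => i; rewrite coef_poly_of pzcoef_mono coefZ coefXn.
by case: eqP; rewrite ?mulr1 ?mulr0 ?rmorph0.
Qed.

Lemma poly_of_const b : poly_of (pzconst b) = (f b)%:P.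
Proof. by rewrite poly_of_mono expr0 alg_polyC. Qed.
End PolynomialOfPzpoly.

(** A polynomial over K has finitely many coefficients, so a common denominator
    in A, which is a unit of k, brings it into the image of B[X]. *)
Lemma PSI_poly_fiber (A B : comPzRingType) (u : {rmorphism A -> B})
    (k : fieldType) (K : comNzRingType) (f : {rmorphism A -> k})
    (i : {rmorphism k -> K}) (g : {rmorphism B -> K}) :
  (forall a, i (f a) = g (u a)) ->
  (forall y : K, exists s b, f s != 0 /\ i (f s) * y = g b) ->
  PSI_morphism (pzpoly_map u : {rmorphism pzpoly A -> pzpoly B}) ->
  PSI_morphism (map_poly i : {rmorphism {poly k} -> {poly K}}).
Proof.
move=> ifgu frac; apply: (PSI_transfer (f := poly_of f) (g := poly_of g)).
  move=> p; apply/polyP => j.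
  by rewrite /= coef_map !coef_poly_of; exact/esym/ifgu.
have map_const s : map_poly i (poly_of f (pzconst s)) = (i (f s))%:P.
  by rewrite poly_of_const map_polyC.
suff clear (G : {poly K}) : exists s q, f s != 0 /\ (i (f s))%:P * G = poly_of g q.
  move=> G; have [s [q [fs e]]] := clear G.
  exists (pzconst s), q, (i (f s)^-1)%:P.
  by rewrite /= map_const -polyCM -rmorphM mulVf // rmorph1.
rewrite -[G]coefK poly_def.
elim: (size G) => [|n [s [q [fs e]]]].
  by exists 1, 0; rewrite !rmorph1 oner_neq0 big_ord0 mulr0 rmorph0.
have [t [b [ft e']]] := frac G`_n.
exists (s * t), (pzconst (u t) * q + pzmono (u s * b) n); split.
  by rewrite rmorphM mulf_neq0.
have poly_ofM x y : poly_of g (x * y) = poly_of g x * poly_of g y by exact: rmorphM.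
rewrite big_ord_recr rmorphD /= poly_ofM poly_of_mono poly_of_const.
by rewrite -e !rmorphM /= -!ifgu -e' -!mul_polyC !polyCM; ring.
Qed.

Lemma fiber_frac (A B : comPzRingType) (u : {rmorphism A -> B})
    (P : spectrum A) (y : tensor (residue_map P) u) :
  exists s b, ~ spectrum_set P s /\
    tensor_inr (residue_map P) u (u s) * y = tensor_inr (residue_map P) u b.
Proof.
have [s ->] := tensor_sum y.
elim: s => [|[q c] s [r [d [Pr e]]]].
  exists 1, 0; split; first exact: spectrum1.
  by rewrite big_nil mulr0 rmorph0.
have [a [t [Pt f]]] := residue_frac q.
exists (r * t), (u (r * a) * c + u t * d); split; first exact: spectrumM.
rewrite big_cons pure_tensorE !rmorphD !rmorphM /= -e -!tensor_comm -f.
by rewrite rmorphM /=; ring.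
Qed.

(** The residue field and the nonzero fiber are given the structures of a field
    and of a nonzero ring, with an inverse obtained by choice, so that the
    results on {poly k} and {poly K} apply to them. *)
Lemma pzpoly_PSI_strong (A B : comPzRingType) (u : {rmorphism A -> B}) :
  PSI_morphism (pzpoly_map u : {rmorphism pzpoly A -> pzpoly B}) ->
  strong_PSI_morphism u.
Proof.
move=> psi P T0; apply: fiber_bijective => // b.
pose inv (x : residue_field P) :=
  if pselect (x <> 0) is left x0 then sval (cid (residue_fieldV x0)) else 0.
have mulVf (x : residue_field P) : x != 0 -> inv x * x = 1.
  move=> /eqP x0; rewrite /inv; case: pselect => [x0'|//].
  by case: cid.
have inv0 : inv 0 = 0 by rewrite /inv; case: pselect.
pose k_nz := GRing.PzSemiRing_isNonZero.Build (residue_field P)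
  (introN eqP (@residue_field1_neq0 _ P)).
pose k0 : comNzRingType := HB.pack (residue_field P) k_nz.
pose k_field := GRing.ComNzRing_isField.Build k0 mulVf inv0.
pose k : fieldType := HB.pack (residue_field P) k_nz k_field.
have K1 : (1 : tensor (residue_map P) u) != 0.
  by apply/eqP => K1; case: T0 => x; apply; rewrite -[x]mul1r K1 mul0r.
pose K_nz := GRing.PzSemiRing_isNonZero.Build (tensor (residue_map P) u) K1.
pose K : comNzRingType := HB.pack (tensor (residue_map P) u) K_nz.
pose f : {rmorphism A -> k} := residue_map P.
pose i : {rmorphism k -> K} := tensor_inl (residue_map P) u.
pose g : {rmorphism B -> K} := tensor_inr (residue_map P) u.
suff : PSI_morphism (map_poly i : {rmorphism {poly k} -> {poly K}}).
  by move=> /poly_PSI_surj/(_ (g b)).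
apply: (PSI_poly_fiber (f := f) (g := g)) psi; first exact: tensor_comm.
move=> y; have [s [c [Ps e]]] := fiber_frac y.
exists s, c; split; first by apply/eqP => /residue_map_eq0.
apply: etrans e; congr (_ * _); exact: tensor_comm.
Qed.

Theorem theorem3p7 (A B : comPzRingType) (u : {rmorphism A -> B}) :
  [<-> strong_PSI_morphism u;
       forall (C : comPzRingType) (v : {rmorphism A -> C}),
         strong_PSI_morphism (tensor_inl v u : {rmorphism C -> tensor v u});
       forall (C : comPzRingType) (v : {rmorphism A -> C}),
         PSI_morphism (tensor_inr u v : {rmorphism C -> tensor u v});
       PSI_morphism (pzpoly_map u : {rmorphism pzpoly A -> pzpoly B})].
Proof.
tfae.
- by move=> spsi C v; exact: strong_PSI_base_change.
- move=> spsi C v; have [h hE surj] := tensor_swap u v.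
  exact: PSI_surjective hE surj (strong_PSI_is_PSI (spsi C v)).
- move=> psi; have [h hE surj] := tensor_pzpoly u.
  exact: PSI_surjective hE surj (psi _ _).
- exact: pzpoly_PSI_strong.
Qed.
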